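(* Let $f,g\colon[0,1]\to[0,1]$ be increasing bijections, and let $\mathrm A(u_1,u_2)=\tfrac12\big(f(u_1)+f(u_2)\big)$ and $\mathrm B(u_1,u_2)=\tfrac12\big(g(u_1)+g(u_2)\big)$, regarded as aggregation functions on $\mathsf{Int}_{[0,1]}$ via $[u_1,u_2]\mapsto \mathrm A(u_1,u_2)$ and $[u_1,u_2]\mapsto\mathrm B(u_1,u_2)$. Then the pair $(\mathrm A,\mathrm B)$ is admissible if and only if $g\circ f^{-1}$ is a strictly convex or strictly concave function.
   Context: Let $\mathsf{Int}_{[0,1]}=\{[a_1,a_2]: 0\le a_1\le a_2\le 1\}$ (degenerate intervals allowed); write $\mathbf u=[u_1,u_2]$. The interval order is: $\mathbf u\preceq_{\mathrm{Int}}\mathbf x$ iff $u_1\le x_1$ and $u_2\le x_2$. An admissible order is a total order $\preceq$ on $\mathsf{Int}_{[0,1]}$ such that $\mathbf u\preceq_{\mathrm{Int}}\mathbf x$ implies $\mathbf u\preceq\mathbf x$. An aggregation function (AF) is a function $\mathrm A\colon\mathsf{Int}_{[0,1]}\to[0,1]$ with $\mathrm A([0,0])=0$, $\mathrm A([1,1])=1$, and $\mathrm A(\mathbf u)\le\mathrm A(\mathbf x)$ whenever $u_1\le x_1$ and $u_2\le x_2$. For a pair $(\mathrm A,\mathrm B)$ of AFs, the relation $\preceq_{\mathrm A,\mathrm B}$ is defined by: $\mathbf u\preceq_{\mathrm A,\mathrm B}\mathbf x$ iff $\mathrm A(\mathbf u)<\mathrm A(\mathbf x)$, or $\mathrm A(\mathbf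 u)=\mathrm A(\mathbf x)$ and $\mathrm B(\mathbf u)\le\mathrm B(\mathbf x)$. The pair $(\mathrm A,\mathrm B)$ is admissible if $\preceq_{\mathrm A,\mathrm B}$ is an admissible order. *)

(* Defs.v *)
From mathcomp Require Import all_boot all_order all_algebra.
From mathcomp Require Import lra.
From mathcomp Require Import boolp classical_sets functions set_interval reals.
From mathcomp Require Import interval_inference topology normedtype convex.

Set Implicit Arguments.
Unset Strict Implicit.
Unset Printing Implicit Defensive.

Import Order.TTheory GRing.Theory Num.Theory.

Local Open Scope classical_set_scope.
Local Open Scope ring_scope.
Local Open Scope convex_scope.

Definition Int01 (R : realType) : Type :=
  {u : R * R | [&& 0 <= u.1, u.1 <= u.2 & u.2 <= 1]}.

Definition lo (R : realType) (u : Int01 R) : R := (val u).1.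
Definition hi (R : realType) (u : Int01 R) : R := (val u).2.

Fact int00_proof (R : realType) :
  [&& 0 <= (0 : R, 0 : R).1, (0 : R, 0 : R).1 <= (0 : R, 0 : R).2
    & (0 : R, 0 : R).2 <= 1].
Proof. by rewrite /= lexx ler01. Qed.

Fact int11_proof (R : realType) :
  [&& 0 <= (1 : R, 1 : R).1, (1 : R, 1 : R).1 <= (1 : R, 1 : R).2
    & (1 : R, 1 : R).2 <= 1].
Proof. by rewrite /= lexx ler01. Qed.

Definition int00 (R : realType) : Int01 R := exist _ (0, 0) (int00_proof R).
Definition int11 (R : realType) : Int01 R := exist _ (1, 1) (int11_proof R).

Definition le_Int (R : realType) : rel (Int01 R) :=
  fun u x => (lo u <= lo x) && (hi u <= hi x).

Definition admissible_order (R : realType) (ord : rel (Int01 R)) : Prop :=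
  [/\ reflexive ord, antisymmetric ord, transitive ord, total ord
    & forall u x, le_Int u x -> ord u x].

Record aggregation_function (R : realType) := AggregationFunction {
  af_fun :> Int01 R -> R;
  af_range : forall u, 0 <= af_fun u <= 1;
  af_int00 : af_fun (int00 R) = 0;
  af_int11 : af_fun (int11 R) = 1;
  af_mono : forall u x, le_Int u x -> af_fun u <= af_fun x
}.

Definition lex_order (R : realType) (A B : aggregation_function R) :
    rel (Int01 R) :=
  fun u x => (A u < A x) || ((A u == A x) && (B u <= B x)).

Definition admissible_pair (R : realType) (A B : aggregation_function R) :
    Prop := admissible_order (lex_order A B).

(* A function [0, 1] -> [0, 1] is represented by a function f : R -> R of
   which only the values on `[0, 1] matter. *)
Definition increasing_bijection (R : realType) (f : R -> R) : Prop :=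
  set_bij `[0, 1] `[0, 1] f /\
  {in `[0, 1]%classic &, {homo f : x y / x <= y}}.

Definition half_sum (R : realType) (f : R -> R) (u : Int01 R) : R :=
  2^-1 * (f (lo u) + f (hi u)).

(* Strict counterparts of the library's convex_function; the condition on t
   excludes the endpoints, where equality always holds. *)
Definition strictly_convex (R : realType) (D : set R) (h : R -> R) : Prop :=
  forall t : {i01 R}, 0 < t%:num < 1 ->
    {in D &, forall x y : R^o, x != y ->
      h (x <| t |> y) < (h x : R^o) <| t |> (h y : R^o)}.

Definition strictly_concave (R : realType) (D : set R) (h : R -> R) : Prop :=
  forall t : {i01 R}, 0 < t%:num < 1 ->
    {in D &, forall x y : R^o, x != y ->
      (h x : R^o) <| t |> (h y : R^o) < h (x <| t |> y)}.

Section HalfSumAF.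
Variables (R : realType) (f : R -> R) (hf : increasing_bijection f).

Fact lo_itv (u : Int01 R) : lo u \in `[0, 1]%classic.
Proof.
have /and3P[a0 ab b1] := valP u.
by rewrite inE /= in_itv /= a0 (le_trans ab b1).
Qed.

Fact hi_itv (u : Int01 R) : hi u \in `[0, 1]%classic.
Proof.
have /and3P[a0 ab b1] := valP u.
by rewrite inE /= in_itv /= (le_trans a0 ab) b1.
Qed.

Fact inc_bij_range (x : R) : x \in `[0, 1]%classic -> 0 <= f x <= 1.
Proof.
by case: hf => -[hfun _ _] _; rewrite inE => /hfun; rewrite /= in_itv.
Qed.

Fact inc_bij0 : f 0 = 0.
Proof.
case: hf => -[_ _ hsurj] hmon.
have m0 : (0 : R) \in `[0, 1]%classic by rewrite inE /= in_itv /= lexx ler01.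
have [|x xI fx] := hsurj 0; first by move: m0; rewrite inE.
have x0 : 0 <= x by move: (xI); rewrite /= in_itv /= => /andP[].
apply/le_anti; have /andP[-> _] := inc_bij_range m0; rewrite andbT.
by rewrite -[leRHS]fx; apply: hmon => //; rewrite inE.
Qed.

Fact inc_bij1 : f 1 = 1.
Proof.
case: hf => -[_ _ hsurj] hmon.
have m1 : (1 : R) \in `[0, 1]%classic by rewrite inE /= in_itv /= lexx ler01.
have [|x xI fx] := hsurj 1; first by move: m1; rewrite inE.
have x1 : x <= 1 by move: (xI); rewrite /= in_itv /= => /andP[].
apply/le_anti; have /andP[_ ->] := inc_bij_range m1; rewrite /=.
by rewrite -[leLHS]fx; apply: hmon => //; rewrite inE.
Qed.

Fact half_sum_range (u : Int01 R) : 0 <= half_sum f u <= 1.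
Proof.
have /andP[? ?] := inc_bij_range (lo_itv u).
have /andP[? ?] := inc_bij_range (hi_itv u).
by rewrite /half_sum; apply/andP; split; lra.
Qed.

Fact half_sum_int00 : half_sum f (int00 R) = 0.
Proof. by rewrite /half_sum /lo /hi /= inc_bij0 addr0 mulr0. Qed.

Fact half_sum_int11 : half_sum f (int11 R) = 1.
Proof. by rewrite /half_sum /lo /hi /= inc_bij1; lra. Qed.

Fact half_sum_mono (u x : Int01 R) :
  le_Int u x -> half_sum f u <= half_sum f x.
Proof.
case: hf => _ hmon /andP[ulo uhi].
have := hmon _ _ (lo_itv u) (lo_itv x) ulo.
have := hmon _ _ (hi_itv u) (hi_itv x) uhi.
by rewrite /half_sum; lra.
Qed.

Definition half_sum_AF : aggregation_function R :=
  AggregationFunction half_sum_range half_sum_int00 half_sum_int11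
    half_sum_mono.

End HalfSumAF.

(* Main.v *)
(** Antisymmetry is the only part of admissibility that can fail.  Put
    [h = g o f^-1], an increasing bijection of [[0, 1]], hence continuous.  In
    the coordinates [(f u_1, f u_2)], antisymmetry says that the defect
    [h p + h q - h p' - h q'] vanishes for no [p < p' <= q' < q] with
    [p + q = p' + q'].  These quadruples form a convex set, so by the
    intermediate value theorem the defect has constant sign there.  If it is
    positive, then [h] minus a chord cannot reach its maximum at an interior
    point (take [p' = q'] there), so [h] is strictly convex; if it is negative,
    the same applies to [- h]. *)

Require Import Defs.
From mathcomp Require Import all_boot all_order all_algebra.
From mathcomp Require Import ring lra.
From mathcomp Require Import boolp classical_sets functions set_interval reals.
From mathcomp Require Import interval_inference topology normedtype convex.
From mathcomp Require Import derive realfun.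

Set Implicit Arguments.
Unset Strict Implicit.
Unset Printing Implicit Defensive.

Import Order.TTheory GRing.Theory Num.Theory.
Import numFieldNormedType.Exports.

Local Open Scope classical_set_scope.
Local Open Scope ring_scope.

(** * Preliminaries on continuity and strict convexity *)

Lemma within_continuous_comp_sub (T U V : topologicalType) (A : set T)
    (B : set U) (f : T -> U) (g : U -> V) :
  set_fun A B f -> {within A, continuous f} -> {within B, continuous g} ->
  {within A, continuous (g \o f)}.
Proof.
move=> /Pfun[F ->] cF cg x.
(* Seen as a map from the subspace [A] to the subspace [B], [F] is continuous, so the usual rule for
   composites applies. *)
have := @subspaceT_continuous T U A B F cF x.
move=> /continuous_comp; apply; exact: cg.
Qed.

(** Exchanging the endpoints turns [t] into [1 - t], so ordered endpoints suffice; this form is also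
    open to linear arithmetic. *)
Lemma strictly_convexP (R : realType) (D : set R) (h : R -> R) :
  strictly_convex D h <-> forall t x y : R, 0 < t < 1 -> x \in D -> y \in D ->
    x < y -> h (t * x + (1 - t) * y) < t * h x + (1 - t) * h y.
Proof.
split=> [cvx t x y t01 xD yD xy|cvx t t01 x y xD yD].
  have [t0 t1] : 0 <= t /\ t <= 1 by lra.
  by have := cvx (Itv01 t0 t1) t01 x y xD yD; rewrite !convRE lt_eqF//; apply.
rewrite !convRE /unstable.onem => /lt_total/orP[xy|yx]; first exact: cvx.
rewrite -[X in X * x](subKr 1) -[X in X * h x](subKr 1).
by rewrite addrC [ltRHS]addrC; apply: cvx => //; lra.
Qed.

(** * Strict convexity and the sign of the defect *)

Section Spread.
Variable R : realType.
Implicit Types (h : R -> R).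

(** In the language of majorization, [(p, q)] strictly majorizes [(p', q')]. The inner pair may be
    degenerate, which the passage to strict convexity exploits. *)
Definition spread (p p' q' q : R) : bool :=
  [&& 0 <= p, p < p', p' <= q', q' < q, q <= 1 & p + q == p' + q'].

(** The difference of the two sides is a convex combination of [c - a] and [d - b]. With the strict
    version below, this makes the set of [spread] quadruples convex. *)
Lemma ler_segment (a b c d l : R) : a <= c -> b <= d -> 0 <= l <= 1 ->
  a + l * (b - a) <= c + l * (d - c).
Proof.
move=> ac bd /andP[l0 l1]; rewrite -subr_ge0.
have -> : c + l * (d - c) - (a + l * (b - a)) =
  (1 - l) * (c - a) + l * (d - b) by ring.
by rewrite addr_ge0// mulr_ge0// subr_ge0.
Qed.

Lemma segment_itv01 (a b l : R) : 0 <= a <= 1 -> 0 <= b <= 1 ->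
  0 <= l <= 1 -> 0 <= a + l * (b - a) <= 1.
Proof.
move=> /andP[a0 a1] /andP[b0 b1] l01.
have := ler_segment a0 b0 l01; have := ler_segment a1 b1 l01.
by rewrite !subrr mulr0 !addr0 => -> ->.
Qed.

Lemma ltr_segment (a b c d l : R) : a < c -> b < d -> 0 <= l <= 1 ->
  a + l * (b - a) < c + l * (d - c).
Proof.
move=> ac bd /andP[l0 l1]; rewrite -subr_gt0.
have -> : c + l * (d - c) - (a + l * (b - a)) =
  (1 - l) * (c - a) + l * (d - b) by ring.
have [->|l_neq0] := eqVneq l 0; first by lra.
have l_gt0 : 0 < l by rewrite lt_neqAle eq_sym l_neq0.
by apply: ltr_wpDl; [apply: mulr_ge0; lra|apply: mulr_gt0; lra].
Qed.

Lemma segment_comp_continuous h (a b : R) :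
  0 <= a <= 1 -> 0 <= b <= 1 -> {within `[0, 1], continuous h} ->
  {within `[0, 1], continuous (fun l : R => h (a + l * (b - a)))}.
Proof.
move=> a01 b01 ch.
pose s (l : R) : R := a + l * (b - a).
apply: (@within_continuous_comp_sub R R R `[0, 1]%classic `[0, 1]%classic s h).
- by move=> l; rewrite /= !in_itv /= => l01; exact: segment_itv01.
- apply: continuous_subspaceT => l.
  by apply: cvgD; [exact: cvg_cst | apply: cvgM; [exact: cvg_id | exact: cvg_cst]].
- exact: ch.
Qed.

(** A change of sign between two quadruples would produce a zero of the defect on the segment
    joining them, at a quadruple that is again [spread]. *)
Lemma spread_same_sign h :
  {within `[0, 1], continuous h} ->
  (forall p p' q' q, spread p p' q' q -> h p + h q != h p' + h q') ->
  forall a a' b' b, spread a a' b' b -> h a' + h b' < h a + h b ->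
  forall p p' q' q, spread p p' q' q -> h p' + h q' < h p + h q.
Proof.
move=> ch h_neq a a' b' b sa ltab p p' q' q sp.
rewrite ltNge le_eqVlt negb_or h_neq//=; apply/negP => ltpq.
pose s x y (l : R) : R := x + l * (y - x).
(* The defect along the segment: positive at [l = 0] by [ltab], negative at [l = 1] by [ltpq]. *)
pose F := ((h \o s a p) + (h \o s b q)) - ((h \o s a' p') + (h \o s b' q')).
have [/and5P[? ? ? ? /andP[? /eqP ?]]] := (sa).
have [/and5P[? ? ? ? /andP[? /eqP ?]]] := (sp).
have cF : {within `[0, 1], continuous F}.
  by apply: within_continuousB; apply: within_continuousD;
    apply: segment_comp_continuous => //; apply/andP; split; lra.
have [] := IVT (v := 0) ler01 cF.
  rewrite /F /s /= !fctE /= !mul0r !mul1r !addr0 !subrKC.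
  by rewrite ge_min le_max; lra.
move=> l; rewrite in_itv /= => l01 /eqP; rewrite /F /= !fctE /= subr_eq0.
apply/negP/h_neq; rewrite /spread /s.
have /andP[F0 _] : 0 <= a + l * (p - a) <= 1 by apply: segment_itv01 => //; lra.
have /andP[_ F1] : 0 <= b + l * (q - b) <= 1 by apply: segment_itv01 => //; lra.
rewrite F0 F1 !ltr_segment ?ler_segment//=.
apply/eqP.
have -> : a + l * (p - a) + (b + l * (q - b)) =
  (a + b) + l * ((p + q) - (a + b)) by ring.
have -> : a' + l * (p' - a') + (b' + l * (q' - b')) =
  (a' + b') + l * ((p' + q') - (a' + b')) by ring.
by congruence.
Qed.

Lemma spread_sign h :
  {within `[0, 1], continuous h} ->
  (forall p p' q' q, spread p p' q' q -> h p + h q != h p' + h q') ->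
  (forall p p' q' q, spread p p' q' q -> h p' + h q' < h p + h q) \/
  (forall p p' q' q, spread p p' q' q -> h p + h q < h p' + h q').
Proof.
move=> ch h_neq.
have [pos|] := pselect (exists a a' b' b, spread a a' b' b /\
  h a' + h b' < h a + h b).
  by left; case: pos => a [a' [b' [b [sa ?]]]]; apply: spread_same_sign sa _.
move=> npos; right => p p' q' q sp; rewrite lt_neqAle h_neq//= leNgt.
by apply/negP => lt; apply: npos; exists p, p', q', q.
Qed.

Lemma spread_strictly_convex h :
  {within `[0, 1], continuous h} ->
  (forall p p' q' q, spread p p' q' q -> h p' + h q' < h p + h q) ->
  strictly_convex `[0, 1] h.
Proof.
move=> ch hS.
apply/strictly_convexP => t x y t01; rewrite !inE /= !in_itv /=.
move=> /andP[x0 _] /andP[_ y1] xy; rewrite ltNge; apply/negP => le_t.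
pose m := (h y - h x) / (y - x).
have mE : m * (y - x) = h y - h x by rewrite divfK//; lra.
(* The height of [h] above its chord over [[x, y]]; the assumed failure of strict convexity at [t]
   will read [0 <= phi z]. *)
pose phi := h - (fun z : R => h x + m * (z - x)).
have phix : phi x = 0 by rewrite /phi !fctE; lra.
have phiy : phi y = 0 by rewrite /phi !fctE; lra.
pose z := t * x + (1 - t) * y.
have z_in : x < z < y by rewrite /z; nra.
have phiz : 0 <= phi z.
  rewrite /phi !fctE -/z in le_t *.
  have -> : m * (z - x) = (1 - t) * (m * (y - x)) by rewrite /z; ring.
  by rewrite mE; lra.
have cphi : {within `[x, y], continuous phi}.
  apply: within_continuousB.
    apply: continuous_subspaceW ch => w /=; rewrite !in_itv /=; lra.
  apply: continuous_subspaceT => w.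
  apply: cvgD; first exact: cvg_cst.
  by apply: cvgM; [exact: cvg_cst | apply: cvgB; [exact: cvg_id | exact: cvg_cst]].
have [c xcy c_max] : exists2 c, x < c < y & forall w, x <= w <= y -> phi w <= phi c.
  have [c] := EVT_max (ltW xy) cphi; rewrite in_itv /= => xcy c_max.
  have [c_in|c_out] := boolP (x < c < y).
    by exists c => // w ?; apply: c_max; rewrite in_itv.
  (* If the maximum sits at an endpoint, its value is 0, so the interior point [z] attains it
     too. *)
  exists z => // w wxy; apply: le_trans phiz.
  have <- : phi c = 0.
    have [->//|cx] := eqVneq c x; have [->//|cy] := eqVneq c y.
    by case/negP: c_out; rewrite !lt_neqAle eq_sym cx cy.
  by apply: c_max; rewrite in_itv.
(* The distance from [c] to the nearer endpoint, so that [c - d] and [c + d] stay in [[x, y]]. *)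
pose d := Num.min (c - x) (y - c).
have [d1 d2] : d <= c - x /\ d <= y - c by rewrite !ge_min !lexx orbT.
have d0 : 0 < d by rewrite lt_min; lra.
(* The inner pair is degenerate at [c]. The affine part of [phi] cancels in the defect, so
   maximality at [c] contradicts [hS]. *)
have := hS (c - d) c c (c + d).
have : phi (c - d) <= phi c by apply: c_max; lra.
have : phi (c + d) <= phi c by apply: c_max; lra.
rewrite /phi !fctE /spread.
have -> : m * (c + d - x) = m * (c - x) + m * d by ring.
have -> : m * (c - d - x) = m * (c - x) - m * d by ring.
move=> h1 h2.
have -> : [&& 0 <= c - d, c - d < c, c <= c, c < c + d, c + d <= 1
  & c - d + (c + d) == c + c].
  by apply/and5P; split; [lra..|apply/andP; split; [lra|apply/eqP; lra]].
by move=> /(_ isT); lra.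
Qed.
(** Since the sums agree, [p'] and [q'] are convex combinations of [p] and [q] with exchanged
    weights; adding the two convexity inequalities gives the claim. *)
Lemma strictly_convex_spread h : strictly_convex `[0, 1] h ->
  forall p p' q' q, spread p p' q' q -> h p' + h q' < h p + h q.
Proof.
move=> /strictly_convexP cvx p p' q' q /and5P[p0 pp' p'q' q'q].
move=> /andP[q1 /eqP sumE].
have ltpq : p < q by lra.
have [pI qI] : p \in `[0, 1]%classic /\ q \in `[0, 1]%classic.
  by rewrite !inE /= !in_itv /=; split; lra.
(* The weight for which [p' = t * p + (1 - t) * q]. *)
pose t := (q - p') / (q - p).
have tE : t * (q - p) = q - p' by rewrite divfK//; lra.
have t01 : 0 < t < 1.
  by rewrite divr_gt0 ?subr_gt0//= ?ltr_pdivrMr ?subr_gt0 ?mul1r; lra.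
have s01 : 0 < 1 - t < 1 by lra.
have := cvx t p q t01 pI qI ltpq; have := cvx (1 - t) p q s01 pI qI ltpq.
have -> : t * p + (1 - t) * q = q - t * (q - p) by ring.
have -> : (1 - t) * p + (1 - (1 - t)) * q = p + t * (q - p) by ring.
have -> : p + t * (q - p) = q' by rewrite tE; lra.
by rewrite tE (subKr q); lra.
Qed.

End Spread.

Lemma strictly_convexN (R : realType) (D : set R) (h : R -> R) :
  strictly_convex D (- h) -> strictly_concave D h.
Proof.
move=> cvxN t t01 x y xD yD xy.
by have := cvxN t t01 x y xD yD xy; rewrite -convN ltrN2.
Qed.

Lemma strictly_concaveN (R : realType) (D : set R) (h : R -> R) :
  strictly_concave D h -> strictly_convex D (- h).
Proof.
move=> ccv t t01 x y xD yD xy.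
by have := ccv t t01 x y xD yD xy; rewrite -convN ltrN2.
Qed.


(** * Increasing bijections of the unit interval and their inverses *)

Section IncreasingBijection.
Variable R : realType.
Implicit Types f g : R -> R.

Lemma inc_bij_mono f : increasing_bijection f ->
  {in `[0, 1]%classic &, {mono f : x y / x <= y}}.
Proof.
move=> [[_ finj _] fhomo] x y xI yI; apply/idP/idP; last exact: fhomo.
move=> fxy; rewrite leNgt; apply/negP => yx.
have /finj : f y = f x by apply/le_anti; rewrite fxy fhomo// ltW.
by move=> /(_ yI xI) eq_yx; rewrite eq_yx ltxx in yx.
Qed.

Lemma inc_bij_mem f : increasing_bijection f ->
  forall x, x \in `[0, 1]%classic -> f x \in `[0, 1]%classic.
Proof. by move=> hf x xI; rewrite inE /= in_itv; exact: inc_bij_range. Qed.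

Lemma inc_bij_pinvK f : increasing_bijection f ->
  {in `[0, 1]%classic, cancel ('pinv_(fun=> 0) `[0, 1] f) f}.
Proof. by move=> [[_ _ fsurj] _]; exact: surjpK fsurj. Qed.

Lemma inc_bij_pinvKV f : increasing_bijection f ->
  {in `[0, 1]%classic, cancel f ('pinv_(fun=> 0) `[0, 1] f)}.
Proof. by move=> [[_ finj _] _]; exact: pinvKV. Qed.

Lemma inc_bij_pinv f : increasing_bijection f ->
  increasing_bijection ('pinv_(fun=> 0) `[0, 1] f).
Proof.
move=> hf; have kbij := bijpinv_bij (fun=> 0) hf.1; split=> // x y xI yI xy.
have kI z : z \in `[0, 1]%classic ->
    'pinv_(fun=> 0) `[0, 1] f z \in `[0, 1]%classic.
  by case: kbij => kfun _ _; rewrite !inE => /kfun.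
by rewrite -(inc_bij_mono hf) ?kI// !inc_bij_pinvK.
Qed.

Lemma inc_bij_comp f g : increasing_bijection f -> increasing_bijection g ->
  increasing_bijection (g \o f).
Proof.
move=> hf hg; split; first exact: set_bij_comp hf.1 hg.1.
by move=> x y xI yI xy /=; apply: hg.2; rewrite ?inc_bij_mem//; apply: hf.2.
Qed.

(** A monotone function that is onto an interval has no jumps. *)
Lemma inc_bij_continuous f : increasing_bijection f ->
  {within `[0, 1], continuous f}.
Proof.
move=> hf; apply: segment_inc_surj_continuous.
  by move=> x y xI yI; apply: inc_bij_mono; rewrite ?inE.
by rewrite inc_bij0// inc_bij1//; case: hf => -[].
Qed.

End IncreasingBijection.

(** * From intervals to the defect *)

Lemma exists_Int01 (R : realType) (a b : R) : 0 <= a -> a <= b -> b <= 1 ->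
  exists u : Int01 R, lo u = a /\ hi u = b.
Proof.
move=> a0 ab b1.
have int_ab : [&& 0 <= (a, b).1, (a, b).1 <= (a, b).2 & (a, b).2 <= 1].
  by rewrite /= a0 ab.
by exists (exist _ (a, b) int_ab).
Qed.

(** The relation is the pullback of the lexicographic order along [u |-> (A u, B u)], so
    antisymmetry amounts to injectivity of this map; monotonicity of [A] and [B] yields
    compatibility with [le_Int]. *)
Lemma admissible_pairP (R : realType) (A B : aggregation_function R) :
  admissible_pair A B <-> forall u x, A u = A x -> B u = B x -> u = x.
Proof.
rewrite /admissible_pair /lex_order; split=> [[_ anti _ _ _] u x eqA eqB|AB_inj].
  by apply: anti; rewrite eqA eqB !eqxx !lexx !orbT.
split.
- by move=> u; rewrite eqxx lexx orbT.
- move=> u x; have [//|//|eqA] := ltgtP (A u) (A x) => /= le_ux.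
  by apply: AB_inj => //; apply/le_anti.
- move=> y x z /orP[xy|/andP[/eqP -> xy]] /orP[yz|/andP[/eqP <- yz]].
  + by rewrite (lt_trans xy yz).
  + by rewrite xy.
  + by rewrite yz.
  + by rewrite eqxx (le_trans xy yz) orbT.
- by move=> u x; have [//|//|_] := ltgtP (A u) (A x); exact: le_total.
- by move=> u x ux; rewrite af_mono// andbT orbC -le_eqVlt af_mono.
Qed.

Theorem theorem4p12 (R : realType) (f g : R -> R)
    (hf : increasing_bijection f) (hg : increasing_bijection g) :
  admissible_pair (half_sum_AF hf) (half_sum_AF hg) <->
  (strictly_convex `[0, 1] (g \o 'pinv_(fun=> 0) `[0, 1] f) \/
   strictly_concave `[0, 1] (g \o 'pinv_(fun=> 0) `[0, 1] f)).
Proof.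
set h := g \o _; have hk := inc_bij_pinv hf.
have ch : {within `[0, 1], continuous h}.
  exact/inc_bij_continuous/inc_bij_comp.
rewrite admissible_pairP /= /half_sum; split=> [AB_inj|h_strict].
  (* A zero defect would give two intervals, with endpoints the preimages under [f], that share both
     values: the equal sums are equality of the first functions, the zero defect that of the
     second. *)
  have h_neq p p' q' q : spread p p' q' q -> h p + h q != h p' + h q'.
    move=> /and5P[p0 pp' p'q' q'q /andP[q1 /eqP sumE]]; apply/eqP => sumhE.
    have I (x : R) : 0 <= x <= 1 -> x \in `[0, 1]%classic.
      by move=> x01; rewrite inE /= in_itv.
    have [[pI qI] [p'I q'I]] : (p \in `[0, 1]%classic /\ q \in `[0, 1]%classic) /\
      (p' \in `[0, 1]%classic /\ q' \in `[0, 1]%classic).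
      by split; split; apply: I; lra.
    pose k := 'pinv_(fun=> 0) `[0, 1] f.
    have intP x y : x \in `[0, 1]%classic -> y \in `[0, 1]%classic -> x <= y ->
        exists u : Int01 R, lo u = k x /\ hi u = k y.
      move=> xI yI xy; apply: exists_Int01; last 1 first.
      - by have /andP[] := inc_bij_range hk yI.
      - by have /andP[] := inc_bij_range hk xI.
      - exact: hk.2.
    have lepq : p <= q by lra.
    have [u [lou hiu]] := intP p q pI qI lepq.
    have [x [lox hix]] := intP p' q' p'I q'I p'q'.
    have := AB_inj u x; rewrite lou lox hiu hix !inc_bij_pinvK// sumE.
    rewrite -![g (k _)]/(h _) sumhE => /(_ erefl erefl) ux.
    move: lou; rewrite ux lox => /(congr1 f); rewrite !inc_bij_pinvK// => eq_pp'.
    by rewrite eq_pp' ltxx in pp'.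
  have [pos|neg] := spread_sign ch h_neq; [left|right].
    exact: spread_strictly_convex.
  apply/strictly_convexN/spread_strictly_convex.
    by move=> x; apply: cvgN; exact: ch.
  by move=> p p' q' q /neg; rewrite /= !fctE; lra.
have h_neq p p' q' q : spread p p' q' q -> h p + h q != h p' + h q'.
  move=> s; case: h_strict => [/strictly_convex_spread/(_ _ _ _ _ s)|].
    by move=> /gt_eqF ->.
  move=> /strictly_concaveN/strictly_convex_spread/(_ _ _ _ _ s).
  by rewrite !fctE -!opprD ltrN2 => /lt_eqF ->.
have hE w : w \in `[0, 1]%classic -> h (f w) = g w.
  by move=> wI; rewrite /h /= inc_bij_pinvKV.
have half_inj (a b : R) : 2^-1 * a = 2^-1 * b -> a = b by lra.
(* If [f (lo u) < f (lo x)], the equal sums force [f (hi x) < f (hi u)], which makes a [spread]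
   quadruple with zero defect. Exchanging [u] and [x] gives the other inequality. *)
have lo_eq u x : f (lo u) + f (hi u) = f (lo x) + f (hi x) ->
    g (lo u) + g (hi u) = g (lo x) + g (hi x) -> f (lo x) <= f (lo u).
  move=> fE gE; rewrite leNgt; apply/negP => lt.
  have := h_neq (f (lo u)) (f (lo x)) (f (hi x)) (f (hi u)).
  rewrite !hE ?lo_itv ?hi_itv// gE eqxx => /(_ _)/notF; apply.
  have /andP[u0 _] := inc_bij_range hf (lo_itv u).
  have /andP[_ u1] := inc_bij_range hf (hi_itv u).
  have le_x : f (lo x) <= f (hi x).
    by apply: hf.2; rewrite ?lo_itv ?hi_itv//; case/and3P: (valP x).
  by rewrite /spread u0 u1 le_x lt fE eqxx /= andbT; lra.
move=> u x /half_inj fE /half_inj gE.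
have lofE : f (lo u) = f (lo x) by apply/le_anti; rewrite !lo_eq.
have hifE : f (hi u) = f (hi x) by lra.
have finj : {in `[0, 1]%classic &, injective f} by case: hf => -[].
have loE : lo u = lo x by apply: finj; rewrite ?lo_itv.
have hiE : hi u = hi x by apply: finj; rewrite ?hi_itv.
apply: val_inj; move: loE hiE; rewrite /lo /hi.
by case: (val u) (val x) => [? ?] [? ?] /= -> ->.
Qed.
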